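(* Let $n\geq 2$ and let $|E(G)|_{\max}$ denote the maximum number of edges of a nontrivial connected graph $G$ of order $n$ with $rvd(G)=n-1$. Then $$|E(G)|_{\max}=\begin{cases}1, & n=2,\\ \frac{1}{2}n(n-1)-n+3, & n\geq 3.\end{cases}$$
   Context: All graphs are simple, finite and undirected; the order of $G$ is $n=|V(G)|$, and a graph is nontrivial if it has at least two vertices. Let $G$ be a nontrivial connected graph whose vertices are colored (adjacent vertices may receive the same color). A set $X\subseteq V(G)$ is rainbow if no two vertices of $X$ have the same color. For two distinct vertices $x,y$ of $G$: if $x,y$ are nonadjacent, an $x$-$y$ rainbow vertex-cut is a rainbow set $S\subseteq V(G)\setminus\{x,y\}$ such that $x$ and $y$ belong to different components of $G-S$; if $x,y$ are adjacent, an $x$-$y$ rainbow vertex-cut is a set $S\subseteq V(G)\setminus\{x,y\}$ such that $x$ and $y$ belong to different components of $(G-xy)-S$ and at least one of $S\cup\{x\}$, $S\cup\{y\}$ is rainbow. The coloring is a rainbow vertex-disconnection coloring if every two distinct vertices $x,y$ of $G$ have an $x$-$y$ rainbow vertex-cut. The rainbow vertex-disconnection number $rvd(G)$ is the minimum number of colors in a rainbow vertex-disconnection coloring of $G$. *)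

(* Defs.v *)
From mathcomp Require Import all_boot.

Set Implicit Arguments.
Unset Strict Implicit.
Unset Printing Implicit Defensive.

Record sgraph := SGraph {
  vertex : finType;
  adj : rel vertex;
  adj_sym : symmetric adj;
  adj_irr : irreflexive adj
}.

Definition gorder (G : sgraph) : nat := #|vertex G|.

Definition edges (G : sgraph) : {set {set vertex G}} :=
  [set [set x; y] | x in vertex G, y in vertex G & adj x y].

Definition connected (G : sgraph) : bool :=
  [forall x : vertex G, forall y : vertex G, connect (@adj G) x y].

Definition nontrivial (G : sgraph) : bool := 1 < gorder G.

Definition del_vertices (T : finType) (e : rel T) (S : {set T}) : rel T :=
  [rel u v | [&& e u v, u \notin S & v \notin S]].

Definition del_edge (T : finType) (e : rel T) (x y : T) : rel T :=
  [rel u v | e u v && ([set u; v] != [set x; y])].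

Definition rainbow (T : finType) (C : eqType) (c : T -> C) (X : {set T}) :
  bool := dinjectiveb c X.

(* For x, y outside S, [~~ connect (del_vertices e S) x y] says that x and y  *)
(* lie in different components of the graph obtained from e by removing S.    *)
Definition rainbow_vertex_cut (G : sgraph) (C : eqType) (c : vertex G -> C)
    (x y : vertex G) (S : {set vertex G}) : bool :=
  (S \subset ~: [set x; y]) &&
  if adj x y then
    ~~ connect (del_vertices (del_edge (@adj G) x y) S) x y
    && (rainbow c (x |: S) || rainbow c (y |: S))
  else
    ~~ connect (del_vertices (@adj G) S) x y && rainbow c S.

Definition rvd_coloring (G : sgraph) (C : eqType) (c : vertex G -> C) : bool :=
  [forall x : vertex G, forall y : vertex G, (x != y) ==>
     [exists S : {set vertex G}, rainbow_vertex_cut c x y S]].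

(* The colors are only compared with each other, so a coloring in which       *)
(* exactly k colors occur is taken to be a surjection onto 'I_k.              *)
Definition rvd_colorable (G : sgraph) (k : nat) : bool :=
  [exists c : {ffun vertex G -> 'I_k},
     (#|[set c x | x in vertex G]| == k) && rvd_coloring c].

(* Coloring all vertices differently and taking S = V \ {x, y} always works.  *)
Lemma rvd_colorable_order (G : sgraph) : rvd_colorable G (gorder G).
Proof.
rewrite /gorder; apply/existsP; exists [ffun x => enum_rank x]; apply/andP; split.
  rewrite card_imset // => x y; rewrite !ffunE; exact: enum_rank_inj.
have rb X : rainbow (finfun (@enum_rank (vertex G))) X.
  by apply/dinjectiveP => u v _ _; rewrite !ffunE; apply: enum_rank_inj.
apply/forallP => x; apply/forallP => y; apply/implyP => nxy.
apply/existsP; exists (~: [set x; y]); rewrite /rainbow_vertex_cut subxx !rb /=.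
have key (e : rel (vertex G)) : irreflexive e -> ~~ e x y ->
    ~~ connect (del_vertices e (~: [set x; y])) x y.
  move=> eirr nexy; apply/negP => /connectP [[|z p]] /=.
    by move=> _ eyx; rewrite eyx eqxx in nxy.
  case/andP => /and3P [exz _]; rewrite !inE negbK => /orP [] /eqP zE _ _.
    by rewrite zE eirr in exz.
  by rewrite zE (negbTE nexy) in exz.
case: ifP => axy; rewrite andbT; apply: key.
- by move=> u; rewrite /del_edge /= adj_irr.
- by rewrite /del_edge /= eqxx andbF.
- exact: adj_irr.
- by rewrite axy.
Qed.

Lemma rvd_colorable_ex (G : sgraph) : exists k, rvd_colorable G k.
Proof. by exists (gorder G); apply: rvd_colorable_order. Qed.

Definition rvd (G : sgraph) : nat := ex_minn (rvd_colorable_ex G).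

Definition is_max_edges (P : sgraph -> Prop) (m : nat) : Prop :=
  (exists2 G, P G & #|edges G| = m) /\ (forall G, P G -> #|edges G| <= m).

(* Main.v *)
Require Import Defs.
From mathcomp Require Import all_boot.

(** The maximum is 'C(n, 2) - (n - 3) for every n >= 2 (with truncated
    subtraction, so that n = 2 gives 1): exactly n - 3 pairs of vertices have
    to be nonadjacent.

    At least n - 3 pairs are nonadjacent.  A coloring with n - 1 colors gives
    the same color to two vertices a and b.  A common neighbor of x and y lies
    in every x-y cut ([common_neighbor_in_cut]), and a cut is rainbow, so two
    distinct vertices cannot both be adjacent to both a and b.  Hence all but
    at most one of the n - 2 vertices outside {a, b} are nonadjacent to a or b
    ([card_edges_repeated_color]).

    This is attained by a complete graph on n - 1 vertices together with one
    vertex joined to two vertices b and d of it (only one if n = 2).  Give the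
    new vertex the color of b and let all other colors be distinct.  If the
    neighborhood of x is rainbow, then it provides a cut between x and any other
    vertex; d is the only vertex whose neighborhood may fail to be rainbow, and
    every pair has a member other than d, so the coloring works
    ([rvd_coloring_neighborhoods]).  Fewer colors are impossible if n >= 3: b
    and d are adjacent and all other vertices are adjacent to both, so every b-d
    cut S is V \ {b, d}, and S together with b or d is a rainbow set of n - 1
    vertices ([universal_pair_colors]). *)

Set Implicit Arguments.
Unset Strict Implicit.
Unset Printing Implicit Defensive.

(** * Rainbow cuts and neighborhoods *)

Section Cuts.
Variables (G : sgraph) (C : eqType) (c : vertex G -> C).
Implicit Types (x y w : vertex G) (S X Y : {set vertex G}).

Lemma rainbowS X Y : X \subset Y -> rainbow c Y -> rainbow c X.
Proof.
move=> /subsetP sXY /dinjectiveP injY; apply/dinjectiveP => u v Xu Xv.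
by apply: injY; apply: sXY.
Qed.

Lemma rainbow_cut_rainbow x y S : rainbow_vertex_cut c x y S -> rainbow c S.
Proof.
case/andP => _; case: ifP => _ /andP [_] //.
by case/orP; apply: rainbowS; apply: subsetU1.
Qed.

Lemma common_neighbor_in_cut x y w S :
  rainbow_vertex_cut c x y S -> adj x w -> adj y w -> w \in S.
Proof.
case/andP => /subsetP sS cut xw yw; apply: contraTT cut => nSw.
have nSx : x \notin S by apply/negP => /sS; rewrite !inE eqxx.
have nSy : y \notin S by apply/negP => /sS; rewrite !inE eqxx orbT.
have wx : w != x by apply: contraTneq xw => ->; rewrite adj_irr.
have wy : w != y by apply: contraTneq yw => ->; rewrite adj_irr.
have wy' : adj w y by rewrite adj_sym.
have nxy : w \notin [set x; y] by rewrite !inE negb_or wx.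
have path_xwy (e : rel (vertex G)) : e x w -> e w y ->
    connect (del_vertices e S) x y.
  by move=> exw ewy; apply: (@connect_trans _ _ w); apply: connect1;
    rewrite /del_vertices /= ?exw ?ewy ?nSx ?nSy nSw.
case: ifP => _; rewrite negb_and negbK path_xwy //=; rewrite /del_edge /=.
  by rewrite xw; apply: contra nxy => /eqP <-; rewrite !inE eqxx orbT.
by rewrite wy'; apply: contra nxy => /eqP <-; rewrite !inE eqxx.
Qed.

Lemma rainbow_vertex_cutC x y S :
  rainbow_vertex_cut c x y S = rainbow_vertex_cut c y x S.
Proof.
have symC (e : rel (vertex G)) : symmetric e ->
    connect (del_vertices e S) x y = connect (del_vertices e S) y x.
  move=> esym; apply: sym_connect_sym => u v; rewrite /del_vertices /=.
  by rewrite esym; congr andb; rewrite andbC.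
rewrite /rainbow_vertex_cut setUC adj_sym; congr andb; case: ifP => _.
  rewrite orbC symC; last by move=> u v; rewrite /del_edge /= adj_sym (setUC [set u]).
  by rewrite /del_edge (setUC [set x]).
by rewrite symC //; apply: adj_sym.
Qed.

(** The cut is N(x) minus y: it isolates x once the edge xy, if present, is
    deleted, and in that case adding y restores N(x). *)
Lemma rainbow_neighborhood_cut x y :
  x != y -> rainbow c [set w | adj x w] ->
  rainbow_vertex_cut c x y ([set w | adj x w] :\ y).
Proof.
move=> nxy rN; apply/andP; split.
  apply/subsetP => w; rewrite !inE => /andP [wy xw].
  by rewrite negb_or wy andbT; apply: contraTneq xw => ->; rewrite adj_irr.
have isolated (e : rel (vertex G)) :
    (forall w, e x w -> adj x w) -> ~~ e x y ->
    ~~ connect (del_vertices e ([set w | adj x w] :\ y)) x y.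
  move=> sub nexy; apply/negP => /connectP [[|z p]] /=.
    by move=> _ yx; rewrite yx eqxx in nxy.
  case/andP => /and3P [exz _]; rewrite !inE (sub _ exz) andbT negbK.
  by move=> /eqP zy; rewrite -zy exz in nexy.
case: ifP => xy; apply/andP; split.
- by apply: isolated => [w /andP[]//|]; rewrite /del_edge /= eqxx andbF.
- by apply/orP; right; rewrite setD1K // inE.
- by apply: isolated => //; rewrite xy.
- by apply: rainbowS rN; apply: subD1set.
Qed.

Lemma rvd_coloring_neighborhoods d :
  (forall x, x != d -> rainbow c [set w | adj x w]) -> rvd_coloring c.
Proof.
move=> rN; apply/forallP => x; apply/forallP => y; apply/implyP => nxy.
apply/existsP; have [xd|xd] := eqVneq x d.
  have yx : y != x by rewrite eq_sym.
  exists ([set w | adj y w] :\ x); rewrite rainbow_vertex_cutC.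
  by apply: rainbow_neighborhood_cut => //; apply: rN; rewrite -xd.
by exists ([set w | adj x w] :\ y); apply: rainbow_neighborhood_cut; auto.
Qed.

Lemma rvd_coloring_cut x y :
  rvd_coloring c -> x != y -> exists S, rainbow_vertex_cut c x y S.
Proof.
by move=> /forallP /(_ x) /forallP /(_ y) /implyP rc nxy; apply/existsP/rc.
Qed.

End Cuts.

(** * Counting nonadjacent pairs *)

Lemma edges_sub_pairs (G : sgraph) :
  edges G \subset [set A : {set vertex G} | #|A| == 2].
Proof.
apply/subsetP => A /imset2P [x y _]; rewrite !inE /= => xy ->.
by rewrite cards2; have [yx|//] := eqVneq x y; rewrite yx adj_irr in xy.
Qed.

Lemma in_edges (G : sgraph) (x y : vertex G) :
  ([set x; y] \in edges G) = adj x y.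
Proof.
apply/idP/idP => [/imset2P [u v _] | xy]; last first.
  by apply/imset2P; exists x y; rewrite ?inE.
rewrite inE /= => uv eq_xy.
have nuv : u != v by apply: contraTneq uv => ->; rewrite adj_irr.
have nxy : x != y.
  by have := cards2 x y; rewrite eq_xy cards2 nuv; case: (x != y).
have := set21 x y; have := set22 x y; rewrite eq_xy !inE.
move=> /orP[] /eqP yE /orP[] /eqP xE; move: nxy; rewrite yE xE ?eqxx //.
by rewrite adj_sym.
Qed.

(** Every vertex outside {a, b} that is not adjacent to both a and b is mapped
    to a nonadjacent pair formed with a or b. *)
Lemma card_edges_repeated_color (G : sgraph) (C : eqType) (c : vertex G -> C)
    (a b : vertex G) :
  rvd_coloring c -> a != b -> c a = c b ->
  #|edges G| + (gorder G - 3) <= 'C(gorder G, 2).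
Proof.
move=> rc nab cab.
pose X := ~: [set a; b]; pose W := [set w in X | adj a w && adj b w].
have cardW : #|W| <= 1.
  rewrite leqNgt; apply/negP => /card_gt1P [x [y [Wx Wy nxy]]].
  move: Wx Wy; rewrite !inE => /and3P [_ ax bx] /and3P [_ ay b_y].
  have [S cutS] := rvd_coloring_cut rc nxy.
  have aS : a \in S by apply: (common_neighbor_in_cut cutS); rewrite adj_sym.
  have bS : b \in S by apply: (common_neighbor_in_cut cutS); rewrite adj_sym.
  have /dinjectiveP injS := rainbow_cut_rainbow cutS.
  by rewrite (injS _ _ aS bS cab) eqxx in nab.
(* Either case gives a nonadjacent pair when w is not in W. *)
pose f w := if adj a w then [set w; b] else [set w; a].
have f_inj : {in X :\: W &, injective f}.
  move=> u v; rewrite !inE !negb_or => /andP [_ /andP[ua ub]] /andP [_ /andP[va vb]].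
  move=> fE; have : u \in f v by rewrite -fE /f; case: ifP; rewrite !inE eqxx.
  by rewrite /f; case: ifP; rewrite !inE ?(negbTE ua) ?(negbTE ub) orbF => _ /eqP.
have disj : [disjoint edges G & f @: (X :\: W)].
  apply/pred0P => A /=; apply/negP => /andP [EA /imsetP [w]].
  rewrite !inE negb_and => /andP [/orP[/negbTE -> //|nadj] _] AE.
  by move: EA nadj; rewrite AE /f; case: ifP => aw; rewrite in_edges adj_sym ?aw //= => ->.
have cardX : #|X| = gorder G - 2 by rewrite cardsCs setCK cards2 nab.
rewrite {2}/gorder -card_draws.
have -> : gorder G - 3 = #|X| - 1 by rewrite cardX -subnDA.
apply: (@leq_trans (#|edges G| + #|f @: (X :\: W)|)).
  rewrite leq_add2l card_in_imset // cardsD leq_sub2l //.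
  by apply: leq_trans cardW; apply: subset_leq_card; apply: subsetIr.
move: disj; rewrite -setI_eq0 -cardsUI => /eqP ->; rewrite cards0 addn0.
apply: subset_leq_card; rewrite subUset edges_sub_pairs /=.
apply/subsetP => A /imsetP [w + ->]; rewrite !inE negb_or => /andP [_ /andP [wa wb]].
by rewrite /f; case: ifP => _; rewrite cards2 ?wa ?wb.
Qed.

(** * Bounds on the number of colors *)

Lemma universal_pair_colors (G : sgraph) (b d : vertex G) (k : nat) :
  adj b d ->
  (forall w, w != b -> w != d -> adj b w && adj d w) ->
  rvd_colorable G k -> gorder G - 1 <= k.
Proof.
move=> bd univ /existsP [c /andP [_ rc]].
have nbd : b != d by apply: contraTneq bd => ->; rewrite adj_irr.
have [S cutS] := rvd_coloring_cut rc nbd.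
have SE : S = ~: [set b; d].
  apply/eqP; rewrite eqEsubset; case/andP: (cutS) => -> _ /=.
  apply/subsetP => w; rewrite !inE negb_or => /andP [wb wd].
  by have /andP [bw dw] := univ w wb wd; apply: common_neighbor_in_cut cutS _ _.
have rainbow_le X : rainbow c X -> #|X| <= k.
  move=> /dinjectiveP injX; rewrite -(card_in_imset injX).
  by rewrite -[k in _ <= k]card_ord; apply: max_card.
have cardS z : z \in [set b; d] -> #|z |: S| = gorder G - 1.
  move=> zbd; have le2 : 2 <= gorder G.
    by rewrite /gorder; have := max_card [set b; d]; rewrite cards2 nbd.
  rewrite cardsU1 SE inE zbd /= cardsCs setCK cards2 nbd /=.
  by rewrite -/(gorder G) -(subnKC le2) !addKn.
case/andP: cutS => _; rewrite bd => /andP [_ /orP []] /rainbow_le.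
  by rewrite cardS // set21.
by rewrite cardS // set22.
Qed.

Lemma rvd_eq (G : sgraph) (k : nat) :
  rvd_colorable G k -> (forall j, rvd_colorable G j -> k <= j) -> rvd G = k.
Proof.
rewrite /rvd => colk mink; case: ex_minnP => m colm minm.
by apply/eqP; rewrite eqn_leq minm // mink.
Qed.

Lemma rvd_colorable_rvd (G : sgraph) : rvd_colorable G (rvd G).
Proof. by rewrite /rvd; case: ex_minnP. Qed.

Lemma card_edges_rvd (G : sgraph) :
  nontrivial G -> rvd G = gorder G - 1 ->
  #|edges G| + (gorder G - 3) <= 'C(gorder G, 2).
Proof.
move=> nG rG; have := rvd_colorable_rvd G; rewrite rG.
case/existsP => c /andP [_ rc].
have /injectivePn [a [b nab cab]] : ~~ injectiveb c.
  apply/negP => /injectiveP /leq_card; rewrite card_ord -/(gorder G).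
  by rewrite subn1 leqNgt prednK ?leqnn // ltnW.
exact: card_edges_repeated_color rc nab cab.
Qed.

(** * The extremal graph *)

Section ExtremalGraph.
Variable k : nat.

(** The complete graph on k + 1 vertices [Some i], plus the vertex [None] joined
    to its first and last vertices, which coincide when k = 0. *)
Definition extremal_adj : rel (option 'I_k.+1) := fun x y =>
  match x, y with
  | Some i, Some j => i != j
  | Some i, None | None, Some i => i \in [set ord0; ord_max]
  | None, None => false
  end.

Lemma extremal_adj_sym : symmetric extremal_adj.
Proof. by move=> [i|] [j|] //=; rewrite eq_sym. Qed.

Lemma extremal_adj_irr : irreflexive extremal_adj.
Proof. by move=> [i|] //=; rewrite eqxx. Qed.

Definition extremal_graph : sgraph := SGraph extremal_adj_sym extremal_adj_irr.

Lemma gorder_extremal : gorder extremal_graph = k.+2.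
Proof. by rewrite /gorder /= card_option card_ord. Qed.

Lemma extremal_connected : connected extremal_graph.
Proof.
have conn0 x : connect extremal_adj (Some ord0) x.
  case: x => [i|]; last by apply: connect1; rewrite /= set21.
  by have [<-|ni] := eqVneq ord0 i; [apply: connect0 | apply: connect1].
apply/forallP => x; apply/forallP => y; apply: (connect_trans _ (conn0 y)).
by rewrite (sym_connect_sym extremal_adj_sym); apply: conn0.
Qed.

Lemma extremal_colorable : rvd_colorable extremal_graph k.+1.
Proof.
apply/existsP; exists [ffun x => odflt ord0 x]; apply/andP; split.
  rewrite -[X in _ == X]card_ord -cardsT; apply/eqP; congr #|pred_of_set _|.
  apply/setP => i; rewrite inE; apply/imsetP.
  by exists (Some i) => //; rewrite ffunE.
apply: (@rvd_coloring_neighborhoods extremal_graph _ _ (Some ord_max)) => x xd.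
(* None and Some ord0 are the only two vertices with a common color, and their
   only possible common neighbor is Some ord_max. *)
have nboth : ~~ (extremal_adj x None && extremal_adj x (Some ord0)).
  case: x xd => [i|] //= nmax; have {}nmax : i != ord_max := nmax; rewrite !inE.
  by rewrite (negbTE nmax) orbF andbN.
apply/dinjectiveP => [[i|] [j|]]; rewrite !inE !ffunE //=.
- by move=> _ _ ->.
- by move=> x0 xN i0; rewrite i0 in x0; rewrite xN x0 in nboth.
- by move=> xN x0 i0; rewrite -i0 in x0; rewrite xN x0 in nboth.
Qed.

Lemma extremal_colors j : rvd_colorable extremal_graph j -> k.+1 <= j.
Proof.
(* For k = 0 the first and last vertices coincide, but a color is needed. *)
have [k0|k_gt0] := posnP k.
  by case/existsP => c _; rewrite k0; case: (c None) => i; apply: leq_trans.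
move=> /(@universal_pair_colors extremal_graph (Some ord0) (Some ord_max)).
rewrite gorder_extremal subn1; apply.
  by rewrite /= -val_eqE /= eq_sym -lt0n.
move=> [i|] /=; last by rewrite set21 set22.
by rewrite ![Some _ == _]/eq_op /= !(eq_sym i) => -> ->.
Qed.

Lemma rvd_extremal : rvd extremal_graph = k.+1.
Proof. exact: rvd_eq extremal_colorable extremal_colors. Qed.

(** Every nonadjacent pair consists of [None] and one of the k - 1 vertices
    [Some i] not joined to it (none if k = 0). *)
Lemma card_edges_extremal_ge :
  'C(k.+2, 2) <= #|edges extremal_graph| + (k - 1).
Proof.
pose nonnbrs := ~: [set ord0; ord_max : 'I_k.+1].
have card_nonnbrs : #|nonnbrs| = k - 1.
  rewrite cardsCs setCK card_ord cards2 -val_eqE /= eq_sym.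
  by case: k => [|m] //=; rewrite !subSS.
pose f (i : 'I_k.+1) : {set option 'I_k.+1} := [set None; Some i].
rewrite -card_nonnbrs -gorder_extremal /gorder -card_draws.
apply: (@leq_trans #|edges extremal_graph :|: f @: nonnbrs|); last first.
  apply: leq_trans (leq_add (leqnn _) (leq_imset_card f _)).
  by rewrite cardsU leq_subr.
apply/subset_leq_card/subsetP => A; rewrite inE => /cards2P [x] [y] [nxy ->].
rewrite inE (in_edges (G := extremal_graph)) /=.
case: x y nxy => [i|] [j|] //=; rewrite ?[Some _ == _]/eq_op /=.
- by move=> ->.
- move=> _; rewrite orbC -implyNb; apply/implyP => ni; apply: contraNT ni => ni.
  by rewrite setUC; apply: imset_f; rewrite inE.
- move=> _; rewrite orbC -implyNb; apply/implyP => ni; apply: contraNT ni => ni.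
  by apply: imset_f; rewrite inE.
Qed.

End ExtremalGraph.

(** * The maximum number of edges *)

Theorem theorem4p2 (n : nat) (hn : 2 <= n) :
  is_max_edges
    (fun G : sgraph =>
       [/\ nontrivial G, connected G, gorder G = n & rvd G = n - 1])
    (if n == 2 then 1 else (n * (n - 1)) %/ 2 - n + 3).
Proof.
(* Truncated subtraction makes one expression cover both cases; the regrouping
   for n >= 3 relies on n <= 'C(n, 2). *)
have -> : (if n == 2 then 1 else (n * (n - 1)) %/ 2 - n + 3) = 'C(n, 2) - (n - 3).
  case: eqVneq => [-> //|n2].
  have le3n : 3 <= n by rewrite ltn_neqAle eq_sym n2.
  rewrite divn2 subn1 -bin2 subnBA // addnBAC //.
  by case: n le3n {hn n2} => // m lem; rewrite binS bin1 -add1n leq_add2r bin_gt0.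
have upper G : [/\ nontrivial G, connected G, gorder G = n & rvd G = n - 1] ->
    #|edges G| <= 'C(n, 2) - (n - 3).
  case=> nG _ oG rG; have := card_edges_rvd nG; rewrite rG oG => /(_ erefl).
  by move=> h; rewrite -(leq_add2r (n - 3)) subnK // (leq_trans (leq_addl _ _) h).
split=> //; case: n hn upper => [|[|k]] // _ upper.
have props : [/\ nontrivial (extremal_graph k), connected (extremal_graph k),
    gorder (extremal_graph k) = k.+2 & rvd (extremal_graph k) = k.+2 - 1].
  by rewrite /nontrivial gorder_extremal rvd_extremal subn1 extremal_connected.
exists (extremal_graph k) => //; apply/eqP; rewrite eqn_leq upper //=.
by rewrite leq_subLR addnC !subSS card_edges_extremal_ge.
Qed.
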